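(* (Chain Rule) Let $X$, $Y$, $Z$ be convergence spaces, let $a\in X$, let $f:Y\to Z$ be a function, and let $g:X\to Y$ be a function continuous at $a$. If $L_f\in\mathcal{D}(Y,Z)$ is a differential of $f$ at $g(a)$ and $L_g\in\mathcal{D}(X,Y)$ is a differential of $g$ at $a$, then $L_f\circ L_g$ is a differential of $f\circ g$ at $a$.
   Context: A filter on a set is a nonempty collection of nonempty subsets closed under supersets and finite intersections. A convergence structure on a set $X$ is a relation $\mathcal{F}\to p$ between filters on $X$ and points of $X$ such that for each $p$ the filters converging to $p$ form a filter on the set of filters on $X$ that contains the point filter $[p]=\{A: p\in A\}$; a convergence space is a set with a convergence structure. A function is continuous at $a$ if it maps filters converging to $a$ to (filters generating) filters converging to the image of $a$. $C(X,Y)$ is the set of continuous maps $X\to Y$ with the continuous convergence structure: $\mathcal{F}\to h$ iff for each $x\in X$ and each filter $\mathcal{A}\to x$, the filter generated by $\{F\cdot A: F\in\mathcal{F},A\in\mathcal{A}\}$, where $F\cdot A=\{k(y):k\in F,y\in A\}$, converges to $h(x)$. For all convergence spaces $X,Y$ a subspace $\mathcal{D}(X,Y)$ of $C(X,Y)$ (with induced convergence) is chosen as the space of admissible differentials, with the standing requirement that these choices are closed under composition: $L\circ M\in\mathcal{D}(X,Z)$ whenever $M\in\mathcal{D}(X,Y)$, $L\in\mathcal{D}(Y,Z)$. Differential: for $L\in\mathcal{D}(X,Y)$, $f:X\to Y$, $a\in X$, $L$ is a differential of $f$ at $a$ iff for every filter $\mathcal{A}\to a$ in $X$ there is a filter $\mathcal{L}\to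 L$ in $\mathcal{D}(X,Y)$ such that for every $K\in\mathcal{L}$ there is $A\in\mathcal{A}$ with $f(x)\in K\cdot\{x\}$ for every $x\in A$. *)

(* Defs.v *)
From HB Require Import structures.
From mathcomp Require Import all_boot.
From mathcomp Require Import boolp classical_sets functions filter.

Set Implicit Arguments.
Unset Strict Implicit.
Unset Printing Implicit Defensive.

Local Open Scope classical_set_scope.

(* [conv F p] reads "F converges to p".  Filters are [ProperFilter]s; [conv] is
   a relation on all set systems, which [conv_proper] confines to filters.
   [conv_fine] and [convI] say that the filters converging to p form a filter of
   the poset of filters on T ordered by inclusion, the binary meets of which
   are intersections. *)
HB.mixin Record isConvergence T := {
  conv : set_system T -> T -> Prop ;
  conv_proper : forall F p, conv F p -> ProperFilter F ;
  conv_point : forall p, conv (principal_filter p) p ;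
  conv_fine : forall F G p, ProperFilter G -> F `<=` G -> conv F p -> conv G p ;
  convI : forall F G p, conv F p -> conv G p -> conv (F `&` G) p
}.

#[short(type="convergenceType")]
HB.structure Definition Convergence := {T of isConvergence T}.

Arguments conv_proper {s F p}.
Arguments conv_fine {s F G p}.
Arguments convI {s F G p}.

Section continuity.
Variables X Y : convergenceType.

(* [fmap f F], i.e. [set B | F (f @^-1` B)], is the filter generated by the
   images under f of the members of F. *)
Definition conv_continuous_at (f : X -> Y) (a : X) :=
  forall F, conv F a -> conv (fmap f F) (f a).

Record contMap := ContMap {
  contMap_fun :> X -> Y ;
  contMap_continuous : forall x, conv_continuous_at contMap_fun x
}.

Definition dot (F : set contMap) (A : set X) : set Y :=
  [set z | exists2 k : contMap, F k & exists2 y, A y & z = k y].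

(* The sets [dot K B] form a filter base, so [filter_from] is the filter they
   generate. *)
Definition dot_filter (F : set_system contMap) (A : set_system X) :
    set_system Y :=
  filter_from (F `*` A) (fun KB => dot KB.1 KB.2).

Definition continuous_conv (F : set_system contMap) (h : contMap) :=
  ProperFilter F /\ forall x A, conv A x -> conv (dot_filter F A) (h x).

Lemma dot_filter_proper F A :
  ProperFilter F -> ProperFilter A -> ProperFilter (dot_filter F A).
Proof.
move=> FF FA; apply: filter_from_proper.
  apply: filter_from_filter.
    by exists (setT, setT); split; exact: filterT.
  move=> [K B] [K' B'] [/= FK AB] [/= FK' AB']; exists (K `&` K', B `&` B').
    by split; exact: filterI.
  by move=> _ [k [Kk K'k] [y [By B'y] ->]]; split; exists k => //; exists y.
move=> [K B] [/= /filter_ex [k Kk] /filter_ex [y By]].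
by exists (k y); exists k => //; exists y.
Qed.

Lemma continuous_conv_proper F h : continuous_conv F h -> ProperFilter F.
Proof. by case. Qed.

Lemma continuous_conv_point h : continuous_conv (principal_filter h) h.
Proof.
split; first exact: principal_filter_proper.
move=> x A Ax; have PA := conv_proper Ax.
apply: conv_fine (contMap_continuous h Ax).
  by apply: dot_filter_proper; exact: principal_filter_proper.
move=> P AP; exists ([set h], h @^-1` P).
  by split=> //; exact/principal_filterP.
by move=> _ [k -> [y Py ->]].
Qed.

Lemma continuous_conv_fine F G h : ProperFilter G -> F `<=` G ->
  continuous_conv F h -> continuous_conv G h.
Proof.
move=> PG FG [PF Fh]; split=> // x A Ax; have PA := conv_proper Ax.
apply: conv_fine (Fh _ _ Ax); first exact: dot_filter_proper.
by move=> P [[K B] [/= FK AB] KBP]; exists (K, B) => //; split=> //; exact: FG.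
Qed.

Lemma setI_proper_filter T (F G : set_system T) :
  ProperFilter F -> ProperFilter G -> ProperFilter (F `&` G).
Proof.
move=> PF PG; apply: Build_ProperFilter; first by case=> /filter_not_empty.
split; first by split; exact: filterT.
  by move=> P Q [? ?] [? ?]; split; exact: filterI.
by move=> P Q PQ [FP GP]; split; apply: filterS PQ _.
Qed.

Lemma continuous_convI F G h : continuous_conv F h -> continuous_conv G h ->
  continuous_conv (F `&` G) h.
Proof.
move=> [PF Fh] [PG Gh]; have PFG := setI_proper_filter PF PG.
split=> // x A Ax; have PA := conv_proper Ax.
apply: conv_fine (convI (Fh _ _ Ax) (Gh _ _ Ax)).
  exact: dot_filter_proper.
move=> P [[[K B] [/= FK AB] KBP] [[K' B'] [/= GK' AB'] KBP']].
exists (K `|` K', B `&` B').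
  split=> /=; last exact: filterI.
  by split; [apply: filterS FK => k; left|apply: filterS GK' => k; right].
move=> _ [k [Kk|K'k] [y [By B'y] ->]].
  by apply: KBP; exists k => //; exists y.
by apply: KBP'; exists k => //; exists y.
Qed.

HB.instance Definition _ := isConvergence.Build contMap
  continuous_conv_proper continuous_conv_point continuous_conv_fine
  continuous_convI.

End continuity.

Section composition.
Variables X Y Z : convergenceType.

Lemma contMap_comp_continuous (L : contMap Y Z) (M : contMap X Y) x :
  conv_continuous_at (L \o M) x.
Proof.
by move=> F /(contMap_continuous M)/(contMap_continuous L).
Qed.

Definition contMap_comp (L : contMap Y Z) (M : contMap X Y) : contMap X Z :=
  ContMap (@contMap_comp_continuous L M).

End composition.

Section subspace.
Variables (X : convergenceType) (A : set X).

(* [fmap val F] is the filter on X generated by the filter F on A. *)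
Definition induced_conv (F : set_system A) (p : A) :=
  ProperFilter F /\ conv (fmap val F) (val p).

Lemma induced_conv_proper F p : induced_conv F p -> ProperFilter F.
Proof. by case. Qed.

Lemma induced_conv_point p : induced_conv (principal_filter p) p.
Proof.
have PA := principal_filter_proper p; split=> //.
apply: conv_fine (conv_point (val p)) => P /principal_filterP Pp.
exact/principal_filterP.
Qed.

Lemma induced_conv_fine F G p : ProperFilter G -> F `<=` G ->
  induced_conv F p -> induced_conv G p.
Proof.
move=> PG FG [PF Fp]; split=> //; apply: conv_fine Fp => P; exact: FG.
Qed.

Lemma induced_convI F G p : induced_conv F p -> induced_conv G p ->
  induced_conv (F `&` G) p.
Proof.
move=> [PF Fp] [PG Gp]; split; first exact: setI_proper_filter.
exact: convI Fp Gp.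
Qed.

HB.instance Definition _ := isConvergence.Build (set_type A)
  induced_conv_proper induced_conv_point induced_conv_fine induced_convI.

End subspace.

Record admissible := Admissible {
  adiff :> forall X Y : convergenceType, set (contMap X Y) ;
  adiff_closed : forall (X Y Z : convergenceType)
    (M : contMap X Y) (L : contMap Y Z),
    adiff M -> adiff L -> adiff (contMap_comp L M)
}.
Arguments adiff : clear implicits.

(* The composite as a point of the subspace D(X, Z); its underlying map is
   [contMap_comp (val L) (val M)]. *)
Definition adiff_comp (D : admissible) (X Y Z : convergenceType)
    (L : D Y Z) (M : D X Y) : D X Z :=
  SigSub (mem_set (adiff_closed (set_valP M) (set_valP L))).

Definition is_differential (D : admissible) (X Y : convergenceType)
    (L : D X Y) (f : X -> Y) (a : X) :=
  forall A : set_system X, conv A a ->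
  exists2 LL : set_system (D X Y), conv LL L &
  forall K, LL K -> exists2 B, A B &
  forall x, B x -> dot (val @` K) [set x] (f x).

(* Main.v *)
Require Import Defs.
From mathcomp Require Import all_boot.
From mathcomp Require Import boolp classical_sets functions filter.

Local Open Scope classical_set_scope.

(** Composition of admissible differentials is continuous for continuous
    convergence: if [F] converges to [L] and [G] to [M], then the filter
    generated by the sets [K \o N] with [K] in [F] and [N] in [G] converges to
    [L \o M].  For the chain rule, [F] comes from the filter [g(A)], which
    converges to [g a], and [G] from [A] itself: if [g x = m x] with [m] in [N]
    and [f (g x) = l (g x)] with [l] in [K], then [f (g x) = (l \o m) x]. *)

Section adiff_comp_filter.
Context {D : admissible} {X Y Z : convergenceType}.

Definition adiff_comp_set (K : set (D Y Z)) (N : set (D X Y)) : set (D X Z) :=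
  [set h | exists2 l, K l & exists2 m, N m & h = adiff_comp l m].

Definition adiff_comp_filter (F : set_system (D Y Z))
    (G : set_system (D X Y)) : set_system (D X Z) :=
  filter_from (F `*` G) (fun KN => adiff_comp_set KN.1 KN.2).

Lemma adiff_comp_filter_proper F G :
  ProperFilter F -> ProperFilter G -> ProperFilter (adiff_comp_filter F G).
Proof.
move=> FF FG; apply: filter_from_proper.
  apply: filter_from_filter.
    by exists (setT, setT); split; exact: filterT.
  move=> [K N] [K' N'] [/= FK GN] [/= FK' GN']; exists (K `&` K', N `&` N').
    by split; exact: filterI.
  by move=> _ [l [Kl K'l] [m [Nm N'm] ->]]; split; exists l => //; exists m.
move=> [K N] [/= /filter_ex [l Kl] /filter_ex [m Nm]].
by exists (adiff_comp l m); exists l => //; exists m.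
Qed.

Lemma adiff_comp_filter_conv (F : set_system (D Y Z)) (G : set_system (D X Y))
    (L : D Y Z) (M : D X Y) :
  conv F L -> conv G M -> conv (adiff_comp_filter F G) (adiff_comp L M).
Proof.
move=> [PF [_ FL]] [PG [_ GM]].
have PFG := adiff_comp_filter_proper _ _ PF PG.
split=> //; split=> [|x A Ax]; first exact: fmap_proper_filter.
have PA := conv_proper Ax.
(* Since [G] applied to [A] converges to [M x], [F] applied to the result converges to [L (M x)]; as
   [(l \o m) y = l (m y)], the filter in the goal is finer. *)
apply: conv_fine (FL _ _ (GM _ _ Ax)).
  by apply: dot_filter_proper => //; exact: fmap_proper_filter.
move=> P [[K B] [/= FK [[N C] [/= GN AC] NCB]] KBP].
(* The traces of [K] and [N] on the spaces of admissible differentials lie in [F] and [G]. *)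
exists (val @` adiff_comp_set (val @^-1` K) (val @^-1` N), C).
  split=> //=; exists (val @^-1` K, val @^-1` N); first by split.
  by move=> h Kh; exists h.
move=> _ [_ [_ [l Kl [m Nm ->]] <-] [y Cy ->]].
apply: KBP; exists (val l) => //; exists (val m y) => //.
by apply: NCB; exists (val m) => //; exists y.
Qed.

End adiff_comp_filter.

Theorem theorem3p6 (D : admissible) (X Y Z : convergenceType) (a : X)
    (f : Y -> Z) (g : X -> Y) (Lf : D Y Z) (Lg : D X Y)
    (g_cont : conv_continuous_at g a)
    (Lf_diff : is_differential Lf f (g a))
    (Lg_diff : is_differential Lg g a) :
  is_differential (adiff_comp Lf Lg) (f \o g) a.
Proof.
move=> A Aa; have PA := conv_proper Aa.
have [F FLf Ff] := Lf_diff _ (g_cont _ Aa).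
have [G GLg Gg] := Lg_diff _ Aa.
exists (adiff_comp_filter F G); first exact: adiff_comp_filter_conv.
move=> H [[K N] [/= FK GN] KNH].
have [B AB Bf] := Ff _ FK; have [C AC Cg] := Gg _ GN.
(* [B] lies in the image filter of [A] under [g], so its preimage lies in [A]. *)
exists (g @^-1` B `&` C) => [|x [/Bf Bgx /Cg Cx]]; first exact: filterI.
have [_ [l Kl <-] [_ -> fgx]] := Bgx; have [_ [m Nm <-] [_ -> gx]] := Cx.
exists (val (adiff_comp l m)).
  by exists (adiff_comp l m) => //; apply: KNH; exists l => //; exists m.
by exists x => //=; rewrite fgx gx.
Qed.
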